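(* Let $\mathcal{U}_{n,L,\lambda,\sigma,\tau,z}$ be the second colored model of stochastic symplectic ice, with $\sigma,\tau\in S_n$, $\lambda=(\lambda_1\ge\dots\ge\lambda_n\ge0)$ a partition and $L\ge\lambda_1+n$. Assume that $1\le i\le n-1$ and $\sigma(i+1)>\sigma(i)$. Let $s_i$ be the transposition $(i,i+1)$ in the symmetric group $S_n$, and let $s_iz$ be the vector obtained from $z=(z_1,\dots,z_n)$ by interchanging $z_i$ and $z_{i+1}$. Then $$Z(\mathcal{U}_{n,L,\lambda,\sigma s_i,\tau,z})=-A(q,z,i)\,Z(\mathcal{U}_{n,L,\lambda,\sigma,\tau,z})+B(q,z,i)\,Z(\mathcal{U}_{n,L,\lambda,\sigma,\tau,s_iz}),$$ where $$A(q,z,i)=\frac{(1-z_{i+1})(1-qz_i)}{z_{i+1}-z_i},\qquad B(q,z,i)=\frac{1-(q+1)z_i+qz_iz_{i+1}}{z_{i+1}-z_i}.$$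
   Context: Parameters: $q,z_1,\dots,z_n$ are indeterminates (equivalently, generic complex numbers for which every denominator is nonzero); $z_i'=q+1-\frac1{z_i}$. Colors are $c_1,\dots,c_n$ and $c_0:=+$, with labels ordered by $0<1<\dots<n$. Permutations are composed right to left, $(\sigma s_i)(k)=\sigma(s_i(k))$. Vertex weights, as functions of the colors (left, top, right, bottom); unlisted configurations have weight $0$. For every color $x$, $(x,x,x,x)\mapsto1$, and for all labels $\alpha<\beta$: - colored stochastic $\Gamma$ vertex with spectral parameter $z_i$: $(c_\alpha,c_\beta,c_\alpha,c_\beta)\mapsto z_i$, $(c_\beta,c_\alpha,c_\beta,c_\alpha)\mapsto qz_i$, $(c_\beta,c_\alpha,c_\alpha,c_\beta)\mapsto1-qz_i$, $(c_\alpha,c_\beta,c_\beta,c_\alpha)\mapsto1-z_i$. - colored stochastic $\Delta$ vertex with spectral parameter $z_i$: $(c_\alpha,c_\beta,c_\alpha,c_\beta)\mapsto z_i'$, $(c_\beta,c_\alpha,c_\beta,c_\alpha)\mapsto\frac1qz_i'$, $(c_\beta,c_\beta,c_\alpha,c_\alpha)\mapsto1-z_i'$, $(c_\alpha,c_\alpha,c_\beta,c_\beta)\mapsto1-\frac1qz_i'$. Model $\mathcal{U}_{n,L,\lambda,\sigma,\tau,z}$. A rectangular lattice with $2n$ rows numbered $1,\dots,2n$ from bottom to top and $L$ columns numbered $1,\dots,L$ from right to left; for $1\le i\le n$ row $2i-1$ consists of colored stochastic $\Delta$ vertices and row $2i$ of colored stochastic $\Gamma$ vertices, all with spectral parameter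 $z_i$. Boundary conditions: the left edge of row $2i$ carries $c_{\sigma(i)}$ and the left edge of row $2i-1$ carries $+$; all top edges carry $+$; the bottom edge in column $\lambda_i+n+1-i$ carries $c_{\tau(i)}$ for $1\le i\le n$, and other bottom edges carry $+$. On the right, rows $2i$ and $2i-1$ are joined by a cap with weight $K(x,y)$, $x$ and $y$ being the right-most colors of rows $2i$ and $2i-1$: $K(x,y)=1$ if $x=y$ and $K(x,y)=0$ otherwise. The partition function $Z$ is the sum, over all assignments of colors to the edges compatible with the boundary conditions, of the product of all vertex and cap weights. *)

(* Defs.v *)
From HB Require Import structures.
From mathcomp Require Import all_boot all_order all_algebra all_fingroup.

Set Implicit Arguments.
Unset Strict Implicit.
Unset Printing Implicit Defensive.

Import GRing.Theory.
Local Open Scope ring_scope.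

(* The colour c_a is represented by its label a, so that c_0 = + is ord0.     *)
(* Everything else is indexed from 0: k : 'I_n stands for the index k + 1, so *)
(* that the colour c_{k+1} attached to k is [pcolor k].                       *)
Definition color (n : nat) := 'I_n.+1.

Definition plus_color {n : nat} : color n := ord0.

Definition pcolor {n : nat} (k : 'I_n) : color n := lift ord0 k.

Section Weights.
Variables (F : fieldType) (n : nat) (q z : F).

(* The edges of a vertex are listed in the order left, top, right, bottom. *)
Definition gamma_weight (l t r b : color n) : F :=
  if [&& l == t, t == r & r == b] then 1
  else if (l == r) && (t == b) then if (l < t)%N then z else q * z
  else if (l == b) && (t == r) then if (t < l)%N then 1 - q * z else 1 - z
  else 0.

Definition zprime : F := q + 1 - z^-1.

Definition delta_weight (l t r b : color n) : F :=
  if [&& l == t, t == r & r == b] then 1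
  else if (l == r) && (t == b) then
    if (l < t)%N then zprime else q^-1 * zprime
  else if (l == t) && (r == b) then
    if (r < l)%N then 1 - zprime else 1 - q^-1 * zprime
  else 0.

Definition cap_weight (x y : color n) : F := if x == y then 1 else 0.

End Weights.

(* Rows 2k+1 (Delta) and 2k+2 (Gamma) of the lattice, numbered from the       *)
(* bottom, for the 0-based index k; both have spectral parameter z k.         *)
Lemma delta_row_subproof (n : nat) (k : 'I_n) : (k.*2 < n.*2)%N.
Proof. by rewrite ltn_double. Qed.

Lemma gamma_row_subproof (n : nat) (k : 'I_n) : (k.*2.+1 < n.*2)%N.
Proof. by rewrite ltn_Sdouble. Qed.

Definition delta_row {n : nat} (k : 'I_n) : 'I_(n.*2) :=
  Ordinal (delta_row_subproof k).
Definition gamma_row {n : nat} (k : 'I_n) : 'I_(n.*2) :=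
  Ordinal (gamma_row_subproof k).

(* Rows are numbered from bottom to top and columns from right to left. The   *)
(* vertex in row r and column c has right edge s.1 (r, c), left edge          *)
(* s.1 (r, c + 1), bottom edge s.2 (r, c) and top edge s.2 (r + 1, c).        *)
Definition state (n L : nat) : finType :=
  ({ffun 'I_(n.*2) * 'I_L.+1 -> color n} *
   {ffun 'I_(n.*2).+1 * 'I_L -> color n})%type.

Section Edges.
Variables (n L : nat) (s : state n L) (r : 'I_(n.*2)) (c : 'I_L).

Definition left_edge : color n := s.1 (r, lift ord0 c).
Definition right_edge : color n := s.1 (r, widen_ord (leqnSn L) c).
Definition top_edge : color n := s.2 (lift ord0 r, c).
Definition bottom_edge : color n := s.2 (widen_ord (leqnSn n.*2) r, c).

End Edges.

Definition leftmost_edge n L (s : state n L) (r : 'I_(n.*2)) : color n :=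
  s.1 (r, ord_max).
Definition rightmost_edge n L (s : state n L) (r : 'I_(n.*2)) : color n :=
  s.1 (r, ord0).

(* With 1-based i = k + 1, the column lam_i + n + 1 - i is lam_k + n - k, and *)
(* the column with 0-based index c has number c + 1.                          *)
Definition in_column n L (lam : n.-tuple nat) (k : 'I_n) (c : 'I_L) : bool :=
  (c.+1 == tnth lam k + n - k)%N.

Definition boundary n L (lam : n.-tuple nat) (sigma tau : 'S_n)
    (s : state n L) : bool :=
  [&& [forall k : 'I_n, leftmost_edge s (gamma_row k) == pcolor (sigma k)],
      [forall k : 'I_n, leftmost_edge s (delta_row k) == plus_color],
      [forall c : 'I_L, s.2 (ord_max, c) == plus_color],
      [forall c : 'I_L, [forall k : 'I_n,
         in_column lam k c ==> (s.2 (ord0, c) == pcolor (tau k))]]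
    & [forall c : 'I_L,
         [forall k : 'I_n, ~~ in_column lam k c] ==>
           (s.2 (ord0, c) == plus_color)]].

Section PartitionFunction.
Variables (F : fieldType) (q : F) (n L : nat).

Definition state_weight (z : 'I_n -> F) (s : state n L) : F :=
  \prod_(k < n)
    ((\prod_(c < L)
        delta_weight q (z k)
          (left_edge s (delta_row k) c) (top_edge s (delta_row k) c)
          (right_edge s (delta_row k) c) (bottom_edge s (delta_row k) c)) *
     (\prod_(c < L)
        gamma_weight q (z k)
          (left_edge s (gamma_row k) c) (top_edge s (gamma_row k) c)
          (right_edge s (gamma_row k) c) (bottom_edge s (gamma_row k) c)) *
     cap_weight F (rightmost_edge s (gamma_row k))
                  (rightmost_edge s (delta_row k))).

Definition partition_function (lam : n.-tuple nat) (sigma tau : 'S_n)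
    (z : 'I_n -> F) : F :=
  \sum_(s : state n L | boundary lam sigma tau s) state_weight z s.

End PartitionFunction.

(* The coefficients A(q,z,i) and B(q,z,i) with zi = z_i and zj = z_{i+1}. *)
Definition exchange_A (F : fieldType) (q zi zj : F) : F :=
  (1 - zj) * (1 - q * zi) / (zj - zi).

Definition exchange_B (F : fieldType) (q zi zj : F) : F :=
  (1 - (q + 1) * zi + q * zi * zj) / (zj - zi).

(* Main.v *)
Require Import Defs.
From mathcomp Require Import all_boot all_order all_algebra all_fingroup.
From mathcomp Require Import ring zify.

(* Summing a pair of rows (Delta below, Gamma above, joined by a cap) over its
   horizontal edges gives a matrix B_x(z) = \sum_u G_{x,u}(z) D_{+,u}(z) on
   colourings of a horizontal line of vertical edges, x being the left colour
   of the Gamma row, and the partition function is a sum of entries of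
   B_{sigma(n)}(z_n) * ... * B_{sigma(1)}(z_1).  So it suffices to show, for
   colours 0 < x < y, writing a, b for the two spectral parameters,
     (b - a) B_x(b) B_y(a) + (1 - q a)(1 - b) B_y(b) B_x(a)
       = (1 - (q + 1) a + q a b) B_y(a) B_x(b).
   Three Yang-Baxter equations (Gamma-Gamma, Delta-Delta, Gamma-Delta) move
   crossings through the lattice.  As the left edges of Delta rows carry +,
   the Gamma-Delta and Delta-Delta crossings are frozen on the left, so the
   Gamma-Delta equation rewrites c D_{+,s}(b) G_{x,t}(a), for a scalar c, in
   terms of the products G_{x,u}(a) D_{+,v}(b).  Both sides then become
   combinations of G_{y,_}(a) G_{x,_}(b) D_{+,_}(b) D_{+,_}(a), whose
   coefficients agree by a reflection equation for the three R-matrices.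
   The scalar c may vanish; the identity being polynomial once the Delta
   weights are multiplied by q z, it is enough to prove it generically. *)

Set Implicit Arguments.
Unset Strict Implicit.
Unset Printing Implicit Defensive.

Import GRing.Theory.
Local Open Scope ring_scope.

(** * Transfer matrices and sums over paths *)

Section Kernel.
Variables (R : comNzRingType) (S : finType).
Implicit Types K : S -> S -> R.

Definition kmx K : 'M[R]_#|S| := \matrix_(i, j) K (enum_val i) (enum_val j).

Lemma kmxK K x y : kmx K (enum_rank x) (enum_rank y) = K x y.
Proof. by rewrite mxE !enum_rankK. Qed.

Lemma eq_kmx K K' : (forall x y, K x y = K' x y) -> kmx K = kmx K'.
Proof. by move=> eqK; apply/matrixP=> i j; rewrite !mxE. Qed.

Lemma kmxM K K' : kmx K * kmx K' = kmx (fun x y => \sum_s K x s * K' s y).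
Proof.
apply/matrixP=> i j; rewrite !mxE.
rewrite (reindex _ (onW_bij _ (@enum_val_bij S))) /=.
by apply: eq_bigr => k _; rewrite !mxE.
Qed.

Lemma kmxZ a K : a *: kmx K = kmx (fun x y => a * K x y).
Proof. by apply/matrixP=> i j; rewrite !mxE. Qed.

Lemma kmx_sum (I : finType) (K : I -> S -> S -> R) :
  \sum_i kmx (K i) = kmx (fun x y => \sum_i K i x y).
Proof.
by apply/matrixP=> i j; rewrite !mxE summxE; apply: eq_bigr => k _; rewrite mxE.
Qed.

(** An entry of a product of transfer matrices. Paths start at index [m] and end at index 0, because
    columns are numbered from right to left and rows from bottom to top. *)
Definition pathsum m (T : 'I_m -> S -> S -> R) x y : R :=
  \sum_(h : {ffun 'I_m.+1 -> S} | (h ord_max == x) && (h ord0 == y))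
    \prod_(c < m) T c (h (lift ord0 c)) (h (widen_ord (leqnSn m) c)).

Lemma pathsum0 (T : 'I_0 -> S -> S -> R) x y : pathsum T x y = (x == y)%:R.
Proof.
rewrite /pathsum; under eq_bigr do rewrite big_ord0.
have -> : @ord_max 0 = ord0 by apply: val_inj.
case: eqP => [<- | neq_xy]; last first.
  rewrite big1 // => h /andP[/eqP hx /eqP hy].
  by case: neq_xy; rewrite -hx -hy.
rewrite (big_pred1 [ffun=> x]) // => h /=; rewrite andbb.
apply/eqP/eqP => [hx | ->]; last by rewrite ffunE.
by apply/ffunP => k; rewrite ffunE (ord1 k).
Qed.

Lemma pathsumS m (T : 'I_m.+1 -> S -> S -> R) x y :
  pathsum T x y = \sum_s pathsum (fun c => T (lift ord0 c)) x s * T ord0 s y.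
Proof.
pose g (h : {ffun 'I_m.+2 -> S}) : S * {ffun 'I_m.+1 -> S} :=
  (h ord0, [ffun c => h (lift ord0 c)]).
have g_bij : bijective g.
  apply: inj_card_bij; last by rewrite card_prod !card_ffun !card_ord -expnS.
  move=> h h' [eq0 /ffunP eqS]; apply/ffunP => c.
  by case: (unliftP ord0 c) => [c' | ] ->; rewrite ?eq0 //;
    have:= eqS c'; rewrite !ffunE.
transitivity (\sum_(p : S * {ffun 'I_m.+1 -> S} |
     (p.2 ord_max == x) && (p.1 == y))
  (\prod_(c < m)
     T (lift ord0 c) (p.2 (lift ord0 c)) (p.2 (widen_ord (leqnSn m) c)))
  * T ord0 (p.2 ord0) p.1).
  rewrite (reindex _ (onW_bij _ g_bij)) /pathsum; apply: eq_big => [h | h _] /=.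
    by rewrite ffunE; congr ((h _ == _) && _); apply: val_inj.
  rewrite big_ord_recl mulrC !ffunE; congr (_ * T _ _ (h _));
    last exact: val_inj.
  by apply: eq_bigr => c _; rewrite !ffunE; congr (T _ _ (h _)); apply: val_inj.
pose F s (h : {ffun 'I_m.+1 -> S}) :=
  (\prod_(c < m) T (lift ord0 c) (h (lift ord0 c)) (h (widen_ord (leqnSn m) c)))
  * T ord0 (h ord0) s.
under eq_bigl do rewrite andbC.
rewrite -(pair_big (fun s => s == y)
  (fun h : {ffun 'I_m.+1 -> S} => h ord_max == x) F) /=.
rewrite big_pred1_eq /F.
rewrite (partition_big (fun h : {ffun 'I_m.+1 -> S} => h ord0) predT) //=.
apply: eq_bigr => s _; rewrite /pathsum big_distrl /=.
by apply: eq_bigr => h /andP[_ /eqP ->].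
Qed.

Lemma kmx_pathsum m (T : 'I_m -> S -> S -> R) :
  kmx (pathsum T) = \prod_(c < m) kmx (T (rev_ord c)).
Proof.
elim: m T => [|m IHm] T.
  rewrite big_ord0; apply/matrixP=> i j.
  by rewrite !mxE pathsum0 (inj_eq enum_val_inj).
rewrite (eq_kmx (pathsumS T)) -kmxM IHm big_ord_recr /=; congr (_ * kmx (T _)).
  by apply: eq_bigr => c _; congr (kmx (T _)); apply: val_inj; rewrite /= subSn.
by apply: val_inj; rewrite /= subnn.
Qed.

(** [X] is pushed through the matrix product one factor at a time. *)
Lemma pathsum_intertwine m (T T' : 'I_m -> S -> S -> R) X :
    (forall c x y, \sum_s T c x s * X s y = \sum_s X x s * T' c s y) ->
  forall x y, \sum_s pathsum T x s * X s y = \sum_s X x s * pathsum T' s y.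
Proof.
move=> TX x y; rewrite -(kmxK (fun x y => \sum_s pathsum T x s * X s y)) -kmxM.
rewrite -(kmxK (fun x y => \sum_s X x s * pathsum T' s y)) -kmxM !kmx_pathsum.
rewrite (_ : _ * _ = kmx X * \prod_(c < m) kmx (T' (rev_ord c))) //.
elim/big_rec2: _ => [|c A B _ AX]; first by rewrite mul1r mulr1.
by rewrite -mulrA AX !mulrA !kmxM (eq_kmx (TX _)).
Qed.

End Kernel.

(** * Rows of vertices and the train argument *)

Section Rows.
Variables (R : comNzRingType) (C : finType) (L : nat).
Local Notation V := {ffun 'I_L -> C}.
Local Notation H := {ffun 'I_L.+1 -> C}.
(* As for the vertex weights, the arguments are left, top, right, bottom. *)
Implicit Types w : C -> C -> C -> C -> R.

Definition row w x y (t b : V) : R :=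
  pathsum (fun c l r => w l (t c) r (b c)) x y.

(** Two stacked rows, [w1] above [w2], act as one row whose horizontal edges carry pairs of colours:
    the sum over the vertical edges between them factors over the columns. *)
Lemma row_row w1 w2 l1 l2 r1 r2 (t b : V) :
  \sum_m row w1 l1 r1 t m * row w2 l2 r2 m b =
  pathsum (fun c (l r : C * C) =>
      \sum_m w1 l.1 (t c) r.1 m * w2 l.2 m r.2 (b c))
    (l1, l2) (r1, r2).
Proof.
pose g (h : {ffun 'I_L.+1 -> C * C}) : H * H :=
  ([ffun c => (h c).1], [ffun c => (h c).2]).
have g_bij : bijective g.
  apply: inj_card_bij; last first.
    by rewrite card_prod !card_ffun card_prod expnMn.
  move=> h h' [/ffunP eq1 /ffunP eq2]; apply/ffunP => c.
  by have:= eq1 c; have:= eq2 c; rewrite !ffunE [h c]surjective_pairing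
    [h' c]surjective_pairing => /= -> ->.
pose F (p : H * H) (m : V) : R :=
  \prod_(c < L)
   (w1 (p.1 (lift ord0 c)) (t c) (p.1 (widen_ord (leqnSn L) c)) (m c)
    * w2 (p.2 (lift ord0 c)) (m c) (p.2 (widen_ord (leqnSn L) c)) (b c)).
pose P (p : H * H) := ((p.1 ord_max == l1) && (p.1 ord0 == r1)) &&
   ((p.2 ord_max == l2) && (p.2 ord0 == r2)).
transitivity (\sum_m \sum_(p | P p) F p m).
  apply: eq_bigr => m _; rewrite /row /pathsum big_distrlr /= pair_big /=.
  by apply: eq_bigr => p _; rewrite -big_split.
rewrite exchange_big /= (reindex _ (onW_bij _ g_bij)).
apply: eq_big => [h | h _]; first by rewrite /P !ffunE; apply: andbACA.
rewrite bigA_distr_bigA; apply: eq_bigr => m _.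
by apply: eq_bigr => c _; rewrite !ffunE.
Qed.

Definition rowmx w x y : 'M[R]_#|V| := kmx (row w x y).

(** The train argument: the hypothesis moves the crossing [X] past one column, and iterating carries
    it from the right end of the two rows to the left end. *)
Lemma rowmx_exchange w1 w2 w1' w2' (X : C -> C -> C -> C -> R) :
    (forall l1 l2 t b r1 r2,
      \sum_u \sum_v (\sum_m w1 l1 t u m * w2 l2 m v b) * X u v r1 r2 =
      \sum_u \sum_v X l1 l2 u v * \sum_m w1' u t r1 m * w2' v m r2 b) ->
  forall l1 l2 r1 r2,
    \sum_p X p.1 p.2 r1 r2 *: (rowmx w1 l1 p.1 * rowmx w2 l2 p.2) =
    \sum_p X l1 l2 p.1 p.2 *: (rowmx w1' p.1 r1 * rowmx w2' p.2 r2).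
Proof.
move=> ybe l1 l2 r1 r2.
under eq_bigr do rewrite kmxM kmxZ.
under [RHS]eq_bigr do rewrite kmxM kmxZ.
rewrite !kmx_sum; apply: eq_kmx => t b.
under eq_bigr => p _ do rewrite row_row mulrC -surjective_pairing.
under [RHS]eq_bigr => p _ do rewrite row_row -surjective_pairing.
apply: (pathsum_intertwine (X := fun l r => X l.1 l.2 r.1 r.2) _
  (l1, l2) (r1, r2)).
by move=> c l r; have:= ybe l.1 l.2 (t c) (b c) r.1 r.2; rewrite !pair_bigA.
Qed.

End Rows.

(** * Polynomial vertex weights and R-matrices *)

Section Vertices.
Variables (R : comNzRingType) (n : nat).
Local Notation C := (color n).

Definition tri (lt gt eq : R) (x y : nat) : R :=
  if (x < y)%N then lt else if (y < x)%N then gt else eq.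

Definition kron (x y : C) : R := (x == y)%:R.

(* All weights send two incoming colours i1, i2 to the outgoing colours i1, i2
   (coefficients slt, sgt, eq when i1 < i2, i1 > i2, i1 = i2) or i2, i1
   (coefficients wlt, wgt, 0). *)
Definition flow (slt sgt eq wlt wgt : R) (i1 i2 o1 o2 : C) : R :=
  kron o1 i1 * kron o2 i2 * tri slt sgt eq i1 i2
  + kron o1 i2 * kron o2 i1 * tri wlt wgt 0 i1 i2.

Lemma sum_kron (F : C -> R) x : \sum_y kron y x * F y = F x.
Proof.
rewrite (bigD1 x) //= /kron eqxx mul1r big1 ?addr0 // => y /negPf->.
exact: mul0r.
Qed.

Lemma sum_flow1 slt sgt eq wlt wgt i1 i2 o2 (F : C -> R) :
  \sum_o1 flow slt sgt eq wlt wgt i1 i2 o1 o2 * F o1 =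
    kron o2 i2 * tri slt sgt eq i1 i2 * F i1
    + kron o2 i1 * tri wlt wgt 0 i1 i2 * F i2.
Proof.
under eq_bigr do rewrite mulrDl -!mulrA.
by rewrite big_split /= !sum_kron !mulrA.
Qed.

Lemma sum_flow2 slt sgt eq wlt wgt i1 i2 o1 (F : C -> R) :
  \sum_o2 flow slt sgt eq wlt wgt i1 i2 o1 o2 * F o2 =
    kron o1 i1 * tri slt sgt eq i1 i2 * F i2
    + kron o1 i2 * tri wlt wgt 0 i1 i2 * F i1.
Proof.
under eq_bigr do rewrite mulrDl ![kron o1 _ * _]mulrC -!mulrA.
by rewrite big_split /= !sum_kron; congr (_ + _); ring.
Qed.

Lemma sum_flow slt sgt eq wlt wgt i1 i2 (F : C -> C -> R) :
  \sum_o1 \sum_o2 flow slt sgt eq wlt wgt i1 i2 o1 o2 * F o1 o2 =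
    tri slt sgt eq i1 i2 * F i1 i2 + tri wlt wgt 0 i1 i2 * F i2 i1.
Proof.
under eq_bigr do rewrite sum_flow2 -!mulrA.
by rewrite big_split /= !sum_kron.
Qed.

Variable q : R.

Definition gammaw z (l t r b : C) : R :=
  flow z (q * z) 1 (1 - z) (1 - q * z) l t r b.

(* This is [q * z] times the stochastic weight; paths travel from right to
   left in a Delta row. *)
Definition deltaw z (l t r b : C) : R :=
  flow (q * ((q + 1) * z - 1)) ((q + 1) * z - 1) (q * z)
    (q * (1 - q * z)) (1 - z) r t l b.

(** The numerator of [exchange_B]; it is also the weight of a Gamma-Gamma crossing of equal
    colours. *)
Definition Rdiag a b : R := 1 - (q + 1) * a + q * a * b.

Definition RGG a b (l1 l2 r1 r2 : C) : R :=
  flow ((1 - a) * (1 - q * b)) ((1 - q * a) * (1 - b)) (Rdiag a b)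
    (q * (b - a)) (b - a) l1 l2 r1 r2.

Definition RDD a b (l1 l2 r1 r2 : C) : R :=
  flow ((1 - a) * (1 - q * b)) ((1 - q * a) * (1 - b)) (Rdiag b a)
    (a - b) (q * (a - b)) r1 r2 l1 l2.

Definition RGDdiag a b : R := q * ((q + 1) * a * b - a - b).

Definition RGDpass a b : R := RGDdiag a b + (1 - a) * (1 - b).

(** The Gamma line runs from upper left to lower right and the Delta line from upper right to lower
    left, so [l1], [r1] are incoming and [l2], [r2] outgoing. [RGDpass] is, up to a factor [q], the
    weight of distinct colours staying on their lines. *)
Definition RGD a b (l1 l2 r1 r2 : C) : R :=
  flow (- ((1 - a) * (1 - b))) (- (q * (1 - q * a) * (1 - q * b))) (RGDdiag a b)
    (RGDpass a b) (q * RGDpass a b) l1 r1 l2 r2.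

End Vertices.

(** Once the internal edges are summed out, every [tri] compares incoming colours, so their relative
    order fixes all coefficients; the remaining [kron] factors are atoms for [ring]. *)
Ltac order_cases x y z := rewrite /tri;
  case: (ltngtP x y) => ?; case: (ltngtP x z) => ?; case: (ltngtP y z) => ?;
  try (exfalso; lia);
  repeat match goal with e : nat_of_ord ?u = nat_of_ord ?v |- _ =>
    move/ord_inj: e => e; subst end; rewrite ?ltnn.

(** * Yang-Baxter and reflection equations *)

Section YB.
Variables (R : comNzRingType) (n : nat) (q a b : R).
Local Notation C := (color n).

Lemma YBE_GG (l1 l2 t d r1 r2 : C) :
  \sum_u \sum_v (\sum_m gammaw q a l1 t u m * gammaw q b l2 m v d) *
    RGG q a b u v r1 r2
  = \sum_u \sum_v RGG q a b l1 l2 u v *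
     (\sum_m gammaw q b u t r1 m * gammaw q a v m r2 d).
Proof.
(* The sums are regrouped along the direction of the paths, so that each vertex is summed over its
   outgoing internal edges and [sum_flow], [sum_flow1], [sum_flow2] eliminate them. *)
transitivity (\sum_u \sum_m gammaw q a l1 t u m *
   \sum_v gammaw q b l2 m v d * RGG q a b u v r1 r2).
  apply: eq_bigr => u _; under eq_bigr do rewrite mulr_suml.
  rewrite exchange_big; apply: eq_bigr => m _.
  by rewrite mulr_sumr; apply: eq_bigr => v _; rewrite mulrA.
rewrite !sum_flow !sum_flow1 !sum_flow2 /RGG /gammaw /flow /Rdiag.
order_cases l1 l2 t.
all: ring.
Qed.

Lemma YBE_DD (l1 l2 t d r1 r2 : C) :
  \sum_u \sum_v (\sum_m deltaw q a l1 t u m * deltaw q b l2 m v d) *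
    RDD q a b u v r1 r2
  = \sum_u \sum_v RDD q a b l1 l2 u v *
     (\sum_m deltaw q b u t r1 m * deltaw q a v m r2 d).
Proof.
transitivity (\sum_u \sum_v RDD q a b u v r1 r2 *
    \sum_m deltaw q a l1 t u m * deltaw q b l2 m v d).
  by apply: eq_bigr => u _; apply: eq_bigr => v _; apply: mulrC.
transitivity (\sum_u \sum_m deltaw q b u t r1 m *
   \sum_v deltaw q a v m r2 d * RDD q a b l1 l2 u v); last first.
  apply: eq_bigr => u _; under [RHS]eq_bigr do rewrite mulr_sumr.
  rewrite [RHS]exchange_big; apply: eq_bigr => m _.
  by rewrite mulr_sumr; apply: eq_bigr => v _; ring.
rewrite !sum_flow !sum_flow1 !sum_flow2 /RDD /deltaw /flow /Rdiag.
order_cases r1 r2 t.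
all: ring.
Qed.

Lemma YBE_GD (l1 l2 t d r1 r2 : C) :
  \sum_u \sum_v (\sum_m gammaw q a l1 t u m * deltaw q b l2 m v d) *
    RGD q a b u v r1 r2
  = \sum_u \sum_v RGD q a b l1 l2 u v *
     (\sum_m deltaw q b u t r1 m * gammaw q a v m r2 d).
Proof.
transitivity (\sum_u \sum_m gammaw q a l1 t u m *
   \sum_v RGD q a b u v r1 r2 * deltaw q b l2 m v d).
  apply: eq_bigr => u _; under eq_bigr do rewrite mulr_suml.
  rewrite exchange_big; apply: eq_bigr => m _.
  by rewrite mulr_sumr; apply: eq_bigr => v _; ring.
transitivity (\sum_u \sum_m deltaw q b u t r1 m *
   \sum_v RGD q a b l1 l2 u v * gammaw q a v m r2 d); last first.
  apply: eq_bigr => u _; under [RHS]eq_bigr do rewrite mulr_sumr.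
  rewrite [RHS]exchange_big; apply: eq_bigr => m _.
  by rewrite mulr_sumr; apply: eq_bigr => v _; ring.
rewrite !sum_flow !sum_flow1 !sum_flow2.
rewrite /RGD /gammaw /deltaw /flow /RGDpass /RGDdiag.
order_cases l1 t r1.
all: ring.
Qed.

(** The caps turn two paths from the Gamma rows into the Delta rows. On the left the Gamma rows
    cross before the Gamma-Delta crossing, on the right the Delta rows cross after it. Only [g1] and
    [g2] enter, so their order settles every coefficient. *)
Lemma reflection_equation (g1 g2 d1 d2 : C) :
  \sum_s \sum_u RGG q a b g1 g2 s u * RGD q a b u d1 s d2
  = \sum_v \sum_t RDD q b a d1 d2 v t * RGD q a b g2 v g1 t.
Proof.
under [RHS]eq_bigr => v _ do under eq_bigr => t _ do rewrite mulrC.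
rewrite !sum_flow /RGD /RDD /flow /RGDpass /RGDdiag /Rdiag.
order_cases g1 g2 g2.
all: ring.
Qed.

End YB.

(* [scalerAl] and [scalerAr] do not apply: square matrices of arbitrary,
   possibly zero, size have no algebra structure in the library. *)
Lemma mxZAl (R : comNzRingType) n (k : R) (A B : 'M[R]_n) :
  k *: (A * B) = (k *: A) * B.
Proof. exact: scalemxAl. Qed.

Lemma mxZAr (R : comNzRingType) n (k : R) (A B : 'M[R]_n) :
  k *: (A * B) = A * (k *: B).
Proof. exact: scalemxAr. Qed.

(** * The exchange relation for double-row matrices *)

Section DoubleRow.
Variables (R : comNzRingType) (n L : nat) (q : R).
Local Notation C := (color n).
Local Notation G a := (rowmx L (gammaw (n := n) q a)).
Local Notation D a := (rowmx L (deltaw (n := n) q a)).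

Definition dblmx a (x : C) : 'M[R]_#|{ffun 'I_L -> C}| :=
  \sum_u G a x u * D a plus_color u.

Local Notation simp01 := (mul0r, mul1r, mulr0, add0r, addr0, scale0r).

(** At the left crossing the Delta line leaves with [+] while [x] enters on the Gamma line.
    Conservation of colours forces the Delta path to enter with [+] and the Gamma path to keep [x];
    since [x] exceeds [+], the weight is [q * RGDpass q a b]. *)
Lemma GD_left a b x s t : x != plus_color ->
  (q * RGDpass q a b) *: (D b plus_color s * G a x t) =
  \sum_p RGD q a b p.1 p.2 s t *: (G a x p.1 * D b plus_color p.2).
Proof.
move=> x_neq0; rewrite (rowmx_exchange L (YBE_GD q a b)).
rewrite (bigD1 (plus_color, x)) //= big1 ?addr0 => [|[p p'] /= neq_p].
  congr (_ *: _); rewrite /RGD /flow /kron !eqxx ![_ == x]eq_sym (negPf x_neq0).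
  by rewrite /tri ltn0 (_ : 0 < x)%N ?lt0n // ?simp01.
rewrite /RGD /flow /kron ![_ == x]eq_sym (negPf x_neq0) ?simp01.
move: neq_p; rewrite xpair_eqE [plus_color == p]eq_sym [x == p']eq_sym.
by case: eqP => //= _; case: eqP => //= _ _; rewrite ?simp01.
Qed.

(** Both paths leave the left crossing with [+], hence both enter it with [+], and only the diagonal
    weight survives. *)
Lemma DD_left a b s t :
  Rdiag q b a *: (D b plus_color s * D a plus_color t) =
  \sum_p RDD q a b p.1 p.2 s t *: (D a plus_color p.1 * D b plus_color p.2).
Proof.
rewrite (rowmx_exchange L (YBE_DD q a b)).
rewrite (bigD1 (plus_color, plus_color)) //= big1 ?addr0 => [|[p p'] /= neq_p].
  by congr (_ *: _); rewrite /RDD /flow /kron /tri !ltnn ?simp01.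
rewrite /RDD /flow; move: neq_p; rewrite xpair_eqE /kron.
rewrite ![plus_color == _]eq_sym.
by case: eqP => //= _; case: eqP => //= _ _; rewrite ?simp01.
Qed.

(** This crossing is not frozen: [y] and [x] entering on the left leave either exchanged or in
    place, which produces the two terms of the exchange relation. *)
Lemma GG_left a b (x y : C) s t : (x < y)%N ->
  (b - a) *: (G b x s * G a y t)
    + ((1 - q * a) * (1 - b)) *: (G b y s * G a x t) =
  \sum_p RGG q a b p.1 p.2 s t *: (G a y p.1 * G b x p.2).
Proof.
move=> lt_xy; rewrite (rowmx_exchange L (YBE_GG q a b)).
have neq_xy : x != y by apply: contraTneq lt_xy => ->; rewrite ltnn.
rewrite (bigD1 (x, y)) //= (bigD1 (y, x)) /=;
  last by rewrite xpair_eqE eq_sym negb_and neq_xy.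
rewrite big1 ?addr0 => [|[p p'] /= /andP[neq_p neq_p']].
  congr (_ *: _ + _ *: _).
    by rewrite /RGG /flow /kron /tri !eqxx (negPf neq_xy) lt_xy
      ltnNge ltnW //= ?simp01.
  by rewrite /RGG /flow /kron /tri !eqxx eq_sym (negPf neq_xy) lt_xy
    ltnNge ltnW //= ?simp01.
rewrite /RGG /flow; move: neq_p neq_p'; rewrite !xpair_eqE /kron.
case: (p =P x) => [->|_]; case: (p' =P y) => [->|_] //=;
  rewrite ?simp01 //.
- by rewrite (negPf neq_xy) ?simp01.
- by rewrite [y == x]eq_sym (negPf neq_xy) !mulr0 ?simp01.
- by case: eqP => //= _; case: eqP => //= _ _; rewrite ?simp01.
Qed.

(** [GD_left] reverses the two inner rows, which collects the Gamma rows above the Delta rows. *)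
Lemma dblmx_mul a b x y : x != plus_color ->
  (q * RGDpass q a b) *: (dblmx b y * dblmx a x) =
  \sum_p \sum_d RGD q a b p.2 d.1 p.1 d.2 *:
    ((G b y p.1 * G a x p.2) * (D b plus_color d.1 * D a plus_color d.2)).
Proof.
move=> x_neq0.
rewrite /dblmx big_distrlr /= scaler_sumr.
transitivity (\sum_s \sum_t \sum_p RGD q a b p.1 p.2 s t *:
   ((G b y s * G a x p.1) * (D b plus_color p.2 * D a plus_color t))).
  apply: eq_bigr => s _; rewrite scaler_sumr; apply: eq_bigr => t _.
  rewrite mulrA -(mulrA (G b y s)) mxZAl mxZAr GD_left //.
  rewrite mulr_sumr mulr_suml; apply: eq_bigr => p _.
  by rewrite -mxZAr -mxZAl !mulrA.
transitivity (\sum_s \sum_t \sum_u \sum_v RGD q a b u v s t *: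
   ((G b y s * G a x u) * (D b plus_color v * D a plus_color t))).
  by apply: eq_bigr => s _; apply: eq_bigr => t _; rewrite pair_bigA.
rewrite -[RHS](pair_bigA _ (fun s u => \sum_d RGD q a b u d.1 s d.2 *:
   ((G b y s * G a x u) * (D b plus_color d.1 * D a plus_color d.2)))) /=.
apply: eq_bigr => s _; rewrite exchange_big; apply: eq_bigr => u _.
by rewrite exchange_big pair_bigA.
Qed.

Lemma dblmx_exchange_scaled a b (x y : C) : (0 < x)%N -> (x < y)%N ->
  (q * RGDpass q a b) *:
    ((b - a) *: (dblmx b x * dblmx a y)
     + ((1 - q * a) * (1 - b)) *: (dblmx b y * dblmx a x)) =
  (q * RGDpass q a b) *: (Rdiag q a b *: (dblmx a y * dblmx b x)).
Proof.
move=> x_gt0 lt_xy.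
have x_neq0 : x != plus_color by apply: contraTneq x_gt0 => ->; rewrite ltnn.
have y_neq0 : y != plus_color by apply: contraTneq lt_xy => ->; rewrite ltn0.
have sym c d : RGDpass q c d = RGDpass q d c by rewrite /RGDpass /RGDdiag; ring.
have symRGD l1 l2 r1 r2 :
    RGD (n := n) q b a l1 l2 r1 r2 = RGD q a b l1 l2 r1 r2.
  by rewrite /RGD sym; congr (flow _ _ _ _ _ _ _ _ _); rewrite /RGDdiag; ring.
have swap c k (A : 'M[R]_#|{ffun 'I_L -> C}|) : c *: (k *: A) = k *: (c *: A).
  by rewrite !scalerA mulrC.
rewrite scalerDr 3!(swap (q * _)) [in RHS]sym !dblmx_mul //.
(* Both sides are expanded in the products [M e d]: [GG_left] reorders the Gamma rows on the
   left-hand side, [DD_left] the Delta rows on the right-hand side. The coefficients are the two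
   sides of [reflection_equation]. *)
pose M (e d : C * C) := (G a y e.1 * G b x e.2) *
  (D b plus_color d.1 * D a plus_color d.2).
transitivity (\sum_e \sum_d
   (\sum_s \sum_u RGG q a b e.1 e.2 s u * RGD q a b u d.1 s d.2) *: M e d).
  rewrite !scaler_sumr -big_split /=.
  transitivity (\sum_p \sum_d \sum_e
    (RGG q a b e.1 e.2 p.1 p.2 * RGD q a b p.2 d.1 p.1 d.2) *: M e d).
    apply: eq_bigr => p _; rewrite !scaler_sumr -big_split /=.
    apply: eq_bigr => d _.
    rewrite (swap (b - a)) (swap (_ * (1 - b))) -scalerDr.
    rewrite (mxZAl (b - a)) (mxZAl (_ * (1 - b))) -mulrDl.
    rewrite GG_left // mulr_suml scaler_sumr; apply: eq_bigr => e _.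
    by rewrite -mxZAl scalerA mulrC.
  rewrite exchange_big /=; under eq_bigr do rewrite exchange_big.
  rewrite exchange_big /=; apply: eq_bigr => e _; apply: eq_bigr => d _.
  by rewrite pair_bigA scaler_suml.
transitivity (\sum_e \sum_d
   (\sum_v \sum_t RDD q b a d.1 d.2 v t * RGD q a b e.2 v e.1 t) *: M e d).
  by apply: eq_bigr => e _; apply: eq_bigr => d _; rewrite reflection_equation.
rewrite scaler_sumr; apply: eq_bigr => e _.
transitivity (\sum_d \sum_p
  (RDD q b a d.1 d.2 p.1 p.2 * RGD q a b e.2 p.1 e.1 p.2) *: M e d).
  by apply: eq_bigr => d _; rewrite pair_bigA scaler_suml.
rewrite exchange_big /= scaler_sumr; apply: eq_bigr => p _.
rewrite symRGD scalerA mulrC -scalerA mxZAr DD_left mulr_sumr scaler_sumr.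
by apply: eq_bigr => d _; rewrite -mxZAr scalerA mulrC.
Qed.

End DoubleRow.

Lemma dblmx_exchange (R : idomainType) n L (q a b : R) (x y : color n) :
    q * RGDpass q a b != 0 -> (0 < x)%N -> (x < y)%N ->
  (b - a) *: (dblmx L q b x * dblmx L q a y)
     + ((1 - q * a) * (1 - b)) *: (dblmx L q b y * dblmx L q a x) =
  Rdiag q a b *: (dblmx L q a y * dblmx L q b x).
Proof.
move=> c_neq0 x_gt0 lt_xy; have := dblmx_exchange_scaled L q a b x_gt0 lt_xy.
move/matrixP=> eqM; apply/matrixP=> i j; have := eqM i j.
by rewrite [in LHS]mxE [in RHS]mxE => /(mulfI c_neq0).
Qed.

(** * Regrouping the edges of a state into double rows *)

Lemma even_level_subproof (n : nat) (k : 'I_n.+1) : (k.*2 < n.*2.+1)%N.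
Proof. by rewrite ltnS leq_double -ltnS. Qed.

Definition even_level {n : nat} (k : 'I_n.+1) : 'I_(n.*2).+1 :=
  Ordinal (even_level_subproof k).

Definition odd_level {n : nat} (k : 'I_n) : 'I_(n.*2).+1 :=
  widen_ord (leqnSn n.*2) (gamma_row k).

Variant row_spec n : 'I_(n.*2) -> Prop :=
  | GammaRow k : row_spec (gamma_row k)
  | DeltaRow k : row_spec (delta_row k).

Lemma rowP n (r : 'I_(n.*2)) : row_spec r.
Proof.
have lt_r : (r./2 < n)%N by have := ltn_ord r; lia.
have [odd_r | even_r] := boolP (odd r).
  rewrite (_ : r = gamma_row (Ordinal lt_r)); first exact: GammaRow.
  by apply: val_inj => /=; lia.
rewrite (_ : r = delta_row (Ordinal lt_r)); first exact: DeltaRow.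
by apply: val_inj => /=; lia.
Qed.

Variant level_spec n : 'I_(n.*2).+1 -> Prop :=
  | EvenLevel k : level_spec (even_level k)
  | OddLevel k : level_spec (odd_level k).

Lemma levelP n (r : 'I_(n.*2).+1) : level_spec r.
Proof.
have [odd_r | even_r] := boolP (odd r).
  have lt_r : (r./2 < n)%N by have := ltn_ord r; lia.
  rewrite (_ : r = odd_level (Ordinal lt_r)); first exact: OddLevel.
  by apply: val_inj => /=; lia.
have lt_r : (r./2 < n.+1)%N by have := ltn_ord r; lia.
rewrite (_ : r = even_level (Ordinal lt_r)); first exact: EvenLevel.
by apply: val_inj => /=; lia.
Qed.

Section Unfolding.
Variables (n L : nat).
Local Notation V := {ffun 'I_L -> color n}.
Local Notation H := {ffun 'I_L.+1 -> color n}.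

(** Vertical edges on even levels bound the double rows and are shared by neighbours; the other
    edges are interior to a single double row. *)
Definition unfold_state (s : state n L) :
    {ffun 'I_n.+1 -> V} * {ffun 'I_n -> H * H * V} :=
  ([ffun k => [ffun c => s.2 (even_level k, c)]],
   [ffun k => ([ffun c => s.1 (gamma_row k, c)],
               [ffun c => s.1 (delta_row k, c)],
               [ffun c => s.2 (odd_level k, c)])]).

Lemma unfold_state_bij : bijective unfold_state.
Proof.
apply: inj_card_bij => [[h v] [h' v'] [/ffunP eq1 /ffunP eq2] | ].
  congr (_, _); apply/ffunP => -[r c].
    by case: (rowP r) => k; have := eq2 k;
      rewrite !ffunE => -[/ffunP e1 /ffunP e2 _];
      [have := e1 c | have := e2 c]; rewrite !ffunE.
  case: (levelP r) => k.
    by have /ffunP/(_ c) := eq1 k; rewrite !ffunE.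
  by have := eq2 k; rewrite !ffunE => -[_ _ /ffunP/(_ c)]; rewrite !ffunE.
rewrite !(card_prod, card_ffun, card_ord) -!expnD -!expnM -!expnD.
by apply: eq_leq; congr (_ ^ _)%N; lia.
Qed.

End Unfolding.

(** * The partition function as a sum of matrix entries *)

Section Partition.
Variables (R : comNzRingType) (q : R) (n L : nat).
Local Notation V := {ffun 'I_L -> color n}.
Local Notation H := {ffun 'I_L.+1 -> color n}.

(** Free of inverses, hence defined over any commutative ring, in particular over polynomials. *)
Definition poly_state_weight (z : 'I_n -> R) (s : state n L) : R :=
  \prod_(k < n)
    ((\prod_(c < L)
        deltaw q (z k)
          (left_edge s (delta_row k) c) (top_edge s (delta_row k) c)
          (right_edge s (delta_row k) c) (bottom_edge s (delta_row k) c)) *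
     (\prod_(c < L)
        gammaw q (z k)
          (left_edge s (gamma_row k) c) (top_edge s (gamma_row k) c)
          (right_edge s (gamma_row k) c) (bottom_edge s (gamma_row k) c)) *
     (rightmost_edge s (gamma_row k) == rightmost_edge s (delta_row k))%:R).

Definition poly_partition (lam : n.-tuple nat) (sigma tau : 'S_n)
    (z : 'I_n -> R) : R :=
  \sum_(s : state n L | boundary lam sigma tau s) poly_state_weight z s.

Definition bottom_ok (lam : n.-tuple nat) (tau : 'S_n) (b : V) : bool :=
  [forall c : 'I_L, [forall k : 'I_n,
     in_column lam k c ==> (b c == pcolor (tau k))]] &&
  [forall c : 'I_L, [forall k : 'I_n, ~~ in_column lam k c] ==>
     (b c == plus_color)].

(** In [y], the components [y.1.1] and [y.1.2] are the horizontal edges of the Gamma and Delta rows,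
    and [y.2] is the line of vertical edges between them. *)
Definition dbl_weight (z : R) (y : H * H * V) (t b : V) : R :=
  (\prod_(c < L) deltaw q z (y.1.2 (lift ord0 c)) (y.2 c)
      (y.1.2 (widen_ord (leqnSn L) c)) (b c)) *
  (\prod_(c < L) gammaw q z (y.1.1 (lift ord0 c)) (t c)
      (y.1.1 (widen_ord (leqnSn L) c)) (y.2 c)) *
  (y.1.1 ord0 == y.1.2 ord0)%:R.

Definition dbl_left (x : color n) (y : H * H * V) : bool :=
  (y.1.1 ord_max == x) && (y.1.2 ord_max == plus_color).

Definition dbl_kernel z x (t b : V) : R :=
  \sum_(y | dbl_left x y) dbl_weight z y t b.

Lemma dblmx_kernel z x : dblmx L q z x = kmx (dbl_kernel z x).
Proof.
rewrite /dblmx; under eq_bigr do rewrite kmxM.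
rewrite kmx_sum; apply: eq_kmx => t b; rewrite exchange_big /=.
pose F (h : H * H) m := dbl_weight z (h, m) t b.
transitivity (\sum_m \sum_(h : H * H |
     (h.1 ord_max == x) && (h.2 ord_max == plus_color)) F h m);
  last first.
  rewrite exchange_big pair_big_dep /=.
  by apply: eq_big => [[[h1 h2] m]|[[h1 h2] m] _] //=; rewrite andbT.
apply: eq_bigr => m _.
rewrite -(pair_big (fun h : H => h ord_max == x)
  (fun h : H => h ord_max == plus_color)
  (fun h1 h2 => F (h1, h2) m)) /=.
rewrite (partition_big (fun h : H => h ord0) predT) //=.
apply: eq_bigr => u _; rewrite /row /pathsum big_distrlr /=.
apply: eq_bigr => h1 /andP[_ /eqP h1u].
rewrite big_mkcondr /=; apply: eq_bigr => h2 _; rewrite /F /dbl_weight /= h1u.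
by rewrite [h2 ord0 == u]eq_sym; case: (u == h2 ord0);
  rewrite ?mulr1 ?mulr0 // mulrC.
Qed.

(** The even levels form a vertical path from the top line to the bottom line. The top double row
    gives the leftmost factor, whence [rev_ord]. *)
Lemma poly_partition_mx lam sigma tau z :
  poly_partition lam sigma tau z =
  \sum_(b : V | bottom_ok lam tau b)
    (\prod_(k < n) dblmx L q (z (rev_ord k)) (pcolor (sigma (rev_ord k))))
      (enum_rank ([ffun=> plus_color] : V)) (enum_rank b).
Proof.
pose top : V := [ffun=> plus_color].
under [RHS]eq_bigr => b _ do under eq_bigr do rewrite dblmx_kernel.
under [RHS]eq_bigr => b _ do
  rewrite -(kmx_pathsum (fun k => dbl_kernel (z k) (pcolor (sigma k)))) kmxK.
transitivity (\sum_(e : {ffun 'I_n.+1 -> V} |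
     (e ord_max == top) && bottom_ok lam tau (e ord0))
  \prod_(k < n) dbl_kernel (z k) (pcolor (sigma k)) (e (lift ord0 k))
      (e (widen_ord (leqnSn n) k))); last first.
  rewrite (partition_big (fun e : {ffun 'I_n.+1 -> V} => e ord0)
    (bottom_ok lam tau)) /=.
    apply: eq_bigr => b ok_b; rewrite /pathsum; apply: eq_bigl => e.
    by case: (e ord0 =P b) => [-> | _]; rewrite ?ok_b !(andbT, andbF).
  by move=> e /andP[].
pose left_ok (f : {ffun 'I_n -> H * H * V}) :=
  [forall k, dbl_left (pcolor (sigma k)) (f k)].
transitivity (\sum_(p : {ffun 'I_n.+1 -> V} * {ffun 'I_n -> H * H * V} |
     ((p.1 ord_max == top) && bottom_ok lam tau (p.1 ord0)) && left_ok p.2)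
  \prod_(k < n)
     dbl_weight (z k) (p.2 k) (p.1 (lift ord0 k)) (p.1 (widen_ord (leqnSn n) k))).
  rewrite (reindex _ (onW_bij _ (@unfold_state_bij n L))) /=.
  apply: eq_big => [s | s _].
    rewrite /boundary !ffunE.
    have -> : ([ffun c => s.2 (even_level ord_max, c)] == top) =
        [forall c, s.2 (ord_max, c) == plus_color].
      have -> : even_level ord_max = ord_max :> 'I_(n.*2).+1 by apply: val_inj.
      apply/eqP/forallP => [/ffunP eq_top c | eq_top].
        by have := eq_top c; rewrite !ffunE => ->.
      by apply/ffunP => c; rewrite !ffunE; apply/eqP.
    have -> : bottom_ok lam tau [ffun c => s.2 (even_level ord0, c)] =
        bottom_ok lam tau [ffun c => s.2 (ord0, c)].
      by congr (bottom_ok _ _ _); apply/ffunP => c; rewrite !ffunE;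
        congr (s.2 (_, _)); apply: val_inj.
    have -> : left_ok (unfold_state s).2 =
        [forall k, leftmost_edge s (gamma_row k) == pcolor (sigma k)] &&
        [forall k, leftmost_edge s (delta_row k) == plus_color].
      apply/forallP/andP => [ok | [/forallP okG /forallP okD] k].
        by split; apply/forallP => k; have := ok k;
          rewrite /dbl_left !ffunE /= ?ffunE => /andP[].
      by rewrite /dbl_left !ffunE /= ?ffunE; apply/andP; split;
        [apply: okG | apply: okD].
    have -> : bottom_ok lam tau [ffun c => s.2 (ord0, c)] =
        [forall c, [forall k,
           in_column lam k c ==> (s.2 (ord0, c) == pcolor (tau k))]] &&
        [forall c, [forall k, ~~ in_column lam k c] ==>
           (s.2 (ord0, c) == plus_color)].
      by congr (_ && _); apply: eq_forallb => c;
        [apply: eq_forallb => k |]; rewrite ffunE.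
    by rewrite [RHS]andbC -!andbA.
  apply: eq_bigr => k _; rewrite /dbl_weight !ffunE /=.
  congr (_ * _ * _).
    apply: eq_bigr => c _; rewrite ?ffunE; congr deltaw.
      by congr (s.2 (_, _)); apply: val_inj.
    by congr (s.2 (_, _)); apply: val_inj.
  apply: eq_bigr => c _; rewrite ?ffunE; congr gammaw.
  by congr (s.2 (_, _)); apply: val_inj.
rewrite -(pair_big
  (fun e : {ffun 'I_n.+1 -> V} =>
     (e ord_max == top) && bottom_ok lam tau (e ord0))
  left_ok
  (fun e f => \prod_(k < n)
     dbl_weight (z k) (f k) (e (lift ord0 k)) (e (widen_ord (leqnSn n) k)))) /=.
(* For fixed even levels the interiors of the double rows are chosen independently, so the sum of
   products is a product of sums. *)
apply: eq_bigr => e _; rewrite /dbl_kernel bigA_distr_big_dep.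
by apply: eq_bigl => f.
Qed.

End Partition.

(** * Exchanging two adjacent double rows *)

Lemma prod_rev_recr (R : pzRingType) m (T : 'I_m.+1 -> R) :
  \prod_(k < m.+1) T (rev_ord k) =
    \prod_(k < m) T (lift ord0 (rev_ord k)) * T ord0.
Proof.
rewrite big_ord_recr /=; congr (_ * T _);
  last by apply: val_inj; rewrite /= subnn.
by apply: eq_bigr => k _; congr T; apply: val_inj; rewrite /= subSn.
Qed.

(** The induction strips the rightmost factor, of index 0, until [i] itself has index 0; then [T j]
    and [T i] are the last two factors and the rest is common to the three products. *)
Lemma prod_rev_exchange (R : comNzRingType) N m (T1 T2 T3 : 'I_m -> 'M[R]_N)
    (i j : 'I_m) (a b c : R) :
    j = i.+1 :> nat ->
    (forall k, k != i -> k != j -> T1 k = T2 k) ->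
    (forall k, k != i -> k != j -> T3 k = T2 k) ->
    a *: (T1 j * T1 i) + b *: (T2 j * T2 i) = c *: (T3 j * T3 i) ->
  a *: (\prod_(k < m) T1 (rev_ord k)) + b *: (\prod_(k < m) T2 (rev_ord k)) =
    c *: (\prod_(k < m) T3 (rev_ord k)).
Proof.
elim: m T1 T2 T3 i j => [|m IHm] T1 T2 T3 i j; first by case: i.
rewrite !prod_rev_recr.
case: (unliftP ord0 j) => [j' {j}-> | {j}->] //.
case: (unliftP ord0 i) => [i' {i}-> | {i}->].
  move=> [ij] eq12 eq32 eqT.
  have neq_lift (k k' : 'I_m) : k != k' -> lift ord0 k != lift ord0 k'.
    by rewrite (inj_eq lift_inj).
  rewrite (eq12 ord0) // (eq32 ord0) // !mxZAl -mulrDl; congr (_ * _).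
  apply: (IHm (T1 \o lift ord0) (T2 \o lift ord0) (T3 \o lift ord0)
    i' j') => //= k ki kj.
    by apply: eq12; apply: neq_lift.
  by apply: eq32; apply: neq_lift.
case: m j' {IHm} T1 T2 T3 => [|m] j' T1 T2 T3; first by case: j'.
move=> [j'0]; have -> : j' = ord0 by apply: val_inj.
move=> eq12 eq32 eqT.
have recr2 (T : 'I_m.+2 -> 'M[R]_N) := prod_rev_recr (fun k => T (lift ord0 k)).
rewrite !recr2 -!mulrA.
under eq_bigr do rewrite eq12 //.
under [in RHS]eq_bigr do rewrite eq32 //.
by rewrite (mxZAr a) (mxZAr b) (mxZAr c) -mulrDr eqT.
Qed.

Lemma poly_partition_exchange (R : idomainType) (q : R) n L (z : 'I_n -> R)
    lam (sigma tau : 'S_n) (i j : 'I_n) :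
    q * RGDpass q (z i) (z j) != 0 ->
    j = i.+1 :> nat -> (sigma i < sigma j)%N ->
  (z j - z i) * poly_partition q L lam (tperm i j * sigma)%g tau z
  + ((1 - q * z i) * (1 - z j)) * poly_partition q L lam sigma tau z =
  Rdiag q (z i) (z j) *
    poly_partition q L lam sigma tau (fun k => z (tperm i j k)).
Proof.
move=> c_neq0 ij lt_s; rewrite !poly_partition_mx !mulr_sumr -big_split /=.
apply: eq_bigr => b _.
set t := enum_rank _; set e := enum_rank b.
have entry N (a1 a2 a3 : R) (A1 A2 A3 : 'M_N) k l :
    a1 *: A1 + a2 *: A2 = a3 *: A3 ->
    a1 * A1 k l + a2 * A2 k l = a3 * A3 k l.
  by move=> /matrixP/(_ k l); rewrite !mxE.
apply: entry.
apply: (prod_rev_exchange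
  (T1 := fun k => dblmx L q (z k) (pcolor ((tperm i j * sigma)%g k)))
  (T2 := fun k => dblmx L q (z k) (pcolor (sigma k)))
  (T3 := fun k => dblmx L q (z (tperm i j k)) (pcolor (sigma k))) ij).
- by move=> k neq_i neq_j; rewrite permM tpermD // eq_sym.
- by move=> k neq_i neq_j; rewrite tpermD // eq_sym.
(* In [dblmx_exchange], [a] and [b] are [z i] and [z j], while [x] and [y] are the colours of
   [sigma i] and [sigma j]. *)
by rewrite !permM tpermL tpermR; apply: dblmx_exchange; rewrite ?ltnS.
Qed.

Lemma eq_poly_partition (R : comNzRingType) (q : R) n L lam sigma tau
    (z z' : 'I_n -> R) :
  z =1 z' ->
  poly_partition q L lam sigma tau z = poly_partition q L lam sigma tau z'.
Proof.
by move=> eq_z; apply: eq_bigr => s _; apply: eq_bigr => k _; rewrite eq_z.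
Qed.

(** * Change of base ring, for specialising polynomial parameters *)

Section Morphism.
Variables (R R' : comNzRingType) (f : {rmorphism R -> R'}).

Lemma rmorph_tri lt gt eq x y :
  f (tri lt gt eq x y) = tri (f lt) (f gt) (f eq) x y.
Proof. by rewrite /tri; do 2!case: ifP => //. Qed.

Lemma rmorph_flow n slt sgt eq wlt wgt (i1 i2 o1 o2 : color n) :
  f (flow slt sgt eq wlt wgt i1 i2 o1 o2) =
  flow (f slt) (f sgt) (f eq) (f wlt) (f wgt) i1 i2 o1 o2.
Proof.
by rewrite /flow /kron rmorphD !rmorphM !rmorph_tri !rmorph_nat rmorph0.
Qed.

Lemma rmorph_poly_partition q n L (z : 'I_n -> R) lam sigma tau :
  f (poly_partition q L lam sigma tau z) =
  poly_partition (f q) L lam sigma tau (fun k => f (z k)).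
Proof.
rewrite rmorph_sum; apply: eq_bigr => s _.
rewrite rmorph_prod; apply: eq_bigr => k _.
rewrite !rmorphM !rmorph_prod rmorph_nat; congr (_ * _ * _).
  apply: eq_bigr => c _; rewrite rmorph_flow /deltaw.
  by rewrite !(rmorphM, rmorphB, rmorphD, rmorph1).
apply: eq_bigr => c _; rewrite rmorph_flow /gammaw.
by rewrite !(rmorphM, rmorphB, rmorphD, rmorph1).
Qed.

End Morphism.

(** * Return to the stochastic weights over a field *)

Section Field.
Variables (F : fieldType) (q : F).
Hypothesis q_neq0 : q != 0.

Lemma gammawE n (z : F) (l t r b : color n) :
  gammaw q z l t r b = gamma_weight q z l t r b.
Proof.
rewrite /gammaw /flow /kron /tri /gamma_weight.
rewrite ![l == r]eq_sym ![t == b]eq_sym ![l == b]eq_sym ![t == r]eq_sym.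
have [-> | neq] := eqVneq l t.
  rewrite ltnn ?eqxx; case: (r =P t) => [-> | _]; rewrite ?[t == b]eq_sym;
    by case: (b == t); rewrite /= ?(mul0r, mulr0, mulr1, addr0).
have {}neq : (l == t) = false by apply: negPf.
have order : ((t < l) = ~~ (l < t))%N.
  by rewrite ltn_neqAle leqNgt (inj_eq val_inj) eq_sym neq.
rewrite order /=; case: (r =P l) => [-> | _].
  rewrite neq !andbF mul0r mul0r addr0 mul1r.
  by case: (b == t); rewrite ?mul1r ?mul0r //; case: (l < t)%N.
case: (r == t); case: (b == l);
  by rewrite ?(mul0r, mul1r, mulr0, add0r) //=; case: (l < t)%N.
Qed.

Lemma deltawE n (z : F) (l t r b : color n) : z != 0 ->
  deltaw q z l t r b = q * z * delta_weight q z l t r b.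
Proof.
move=> z_neq0.
rewrite /deltaw /flow /kron /tri /delta_weight.
have zE1 : q * z * zprime q z = q * ((q + 1) * z - 1) by rewrite /zprime; field.
have zE2 : q * z * (q^-1 * zprime q z) = (q + 1) * z - 1.
  by rewrite /zprime; field; rewrite z_neq0 q_neq0.
have zE3 : q * z * (1 - zprime q z) = q * (1 - q * z) by rewrite /zprime; field.
have zE4 : q * z * (1 - q^-1 * zprime q z) = 1 - z.
  by rewrite /zprime; field; rewrite z_neq0 q_neq0.
rewrite ![t == b]eq_sym ![r == b]eq_sym ![t == r]eq_sym.
have [-> | neq] := eqVneq r t.
  rewrite ltnn; case: (l =P t) => [-> | _];
    by case: (b == t); rewrite /= ?(mul0r, mulr0, mulr1, mul1r, addr0).
have {}neq : (r == t) = false by apply: negPf.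
have order : ((t < r) = ~~ (r < t))%N.
  by rewrite ltn_neqAle leqNgt (inj_eq val_inj) eq_sym neq.
rewrite order andbF; case: (l =P r) => [-> | _].
  rewrite neq mul0r mul0r addr0 mul1r /=.
  by case: (b == t); rewrite ?mul1r ?mul0r ?mulr0 //; case: (r < t)%N.
case: (l =P t) => [-> | _]; case: (b == r);
  by rewrite ?(mul0r, mul1r, mulr0, add0r) //=; case: (r < t)%N.
Qed.

(** Each of the [L] Delta vertices of row pair [k] contributes a factor [q * z k], whatever the
    state. *)
Lemma poly_partitionE n L (z : 'I_n -> F) lam sigma tau :
    (forall k, z k != 0) ->
  poly_partition q L lam sigma tau z =
  (\prod_k (q * z k) ^+ L) * partition_function q L lam sigma tau z.
Proof.
move=> z_neq0; rewrite mulr_sumr; apply: eq_bigr => s _.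
rewrite -big_split; apply: eq_bigr => k _ /=.
rewrite !mulrA; congr (_ * _ * _); last by rewrite /cap_weight; case: eqP.
  rewrite -[L in _ ^+ L]card_ord -prodr_const -big_split; apply: eq_bigr => c _.
  exact: deltawE.
by apply: eq_bigr => c _; apply: gammawE.
Qed.

(* The exchange relation is only known where [q * RGDpass q (z i) (z j)] can be
   cancelled; it extends to all parameters by moving [z i] to [z i + 'X]. *)
Lemma poly_partition_exchange_field n L (z : 'I_n -> F)
    lam (sigma tau : 'S_n) (i j : 'I_n) :
    j = i.+1 :> nat -> (sigma i < sigma j)%N ->
  (z j - z i) * poly_partition q L lam (tperm i j * sigma)%g tau z
  + ((1 - q * z i) * (1 - z j)) * poly_partition q L lam sigma tau z =
  Rdiag q (z i) (z j) *
    poly_partition q L lam sigma tau (fun k => z (tperm i j k)).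
Proof.
move=> ij lt_s.
have neq_ji : j != i by apply/eqP => /(congr1 val) /=; lia.
pose Z k : {poly F} := (z k)%:P + (if k == i then 'X else 0).
have Z0 k : (Z k).[0] = z k by rewrite /Z; case: ifP; rewrite !hornerE.
have c_neq0 : q%:P * RGDpass q%:P (Z i) (Z j) != 0.
  rewrite mulf_neq0 ?polyC_eq0 //; apply/eqP => pass0.
  have := congr1 (horner^~ 0) pass0; have := congr1 (horner^~ 1) pass0.
  rewrite /RGDpass /RGDdiag /Z eqxx (negPf neq_ji) !hornerE => p1 p0.
  (* [RGDpass] is affine in its first parameter, with slope [e * z j - (q + 1)] and constant term
     [1 - (q + 1) * z j]. If it vanished at both [z i] and [z i + 1], both coefficients would be 0,
     so [e = (q + 1) ^+ 2], that is [q = 0]. The combination below makes this elimination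
     explicit. *)
  case/eqP: q_neq0; pose e := q ^+ 2 + q + 1; pose d := e * z i - (q + 1).
  transitivity (d * (q * ((q + 1) * (z i + 1) * z j - (z i + 1) - z j) +
      (1 - (z i + 1)) * (1 - z j)) -
    (d + e) * (q * ((q + 1) * z i * z j - z i - z j) + (1 - z i) * (1 - z j))).
    by rewrite /d /e; ring.
  by rewrite p1 p0 !mulr0 subr0.
have := congr1 (horner_eval 0)
  (poly_partition_exchange L lam tau c_neq0 ij lt_s).
clearbody Z; rewrite /Rdiag !(rmorphD, rmorphN, rmorphM, rmorph1).
rewrite !rmorph_poly_partition.
rewrite /= /horner_eval !hornerC !Z0.
rewrite !(eq_poly_partition _ _ _ _ _ Z0).
by rewrite (eq_poly_partition _ _ _ _ _ (fun k => Z0 (tperm i j k))).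
Qed.

End Field.

(* The indices i and j = i + 1 are 0-based. In MathComp (s * t)%g k = t (s k),
   so sigma s_i (composed right to left) is (tperm i j * sigma)%g. *)
Theorem theorem4p3 (F : fieldType) (q : F) (n L : nat) (z : 'I_n -> F)
    (lam : n.-tuple nat) (sigma tau : 'S_n) (i j : 'I_n)
    (q_neq0 : q != 0) (z_neq0 : forall k : 'I_n, z k != 0)
    (z_neq : z j - z i != 0)
    (lam_partition : sorted geq lam)
    (L_large : (nth 0 lam 0 + n <= L)%N)
    (ij : j = i.+1 :> nat)
    (sigma_lt : (sigma i < sigma j)%N) :
  partition_function q L lam (tperm i j * sigma)%g tau z =
    - exchange_A q (z i) (z j) * partition_function q L lam sigma tau z
    + exchange_B q (z i) (z j) *
        partition_function q L lam sigma tau (fun k => z (tperm i j k)).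
Proof.
have := poly_partition_exchange_field q_neq0 L z lam tau ij sigma_lt.
rewrite !poly_partitionE //.
(* The normalising factor is symmetric in [z], so all three partition functions carry the same one
   and it cancels. *)
have -> : \prod_k (q * z (tperm i j k)) ^+ L = \prod_k (q * z k) ^+ L.
  by rewrite [RHS](reindex_inj (@perm_inj _ (tperm i j))).
have : \prod_k (q * z k) ^+ L != 0.
  by apply/prodf_neq0 => k _; rewrite expf_neq0 // mulf_neq0.
rewrite /exchange_A /exchange_B /Rdiag.
set P := \prod_k _; set Z1 := partition_function _ _ _ (_ * _)%g _ _.
set Z2 := partition_function _ _ _ _ _ z.
set Z3 := partition_function _ _ _ _ _ _ => P_neq0 eqZ; clearbody P Z1 Z2 Z3.
apply: (mulfI (mulf_neq0 z_neq P_neq0)).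
transitivity ((1 - (q + 1) * z i + q * z i * z j) * (P * Z3)
    - (1 - q * z i) * (1 - z j) * (P * Z2)).
  by rewrite -eqZ; ring.
by field.
Qed.
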